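(* Let $K\subset[0,1]^T$ be a max-$\cdot$ convex compactum, let $h:K\to\mathbb{R}^\tau$ be a $(\cdot,+)$-affine embedding, and put $S=h(K)$. Then the pair $(l_h,h)$ is a homeomorphism of the maps $\beta^\cdot_K:A^\cdot(K)\to K$ and $\beta_S:I(S)\to S$; that is, $l_h:A^\cdot(K)\to I(S)$ and $h:K\to S$ are homeomorphisms and $h\circ\beta^\cdot_K=\beta_S\circ l_h$.
   Context: Compacta are compact Hausdorff spaces. $C(X)$ is the set of continuous real functions on a compactum $X$, $C(X,[0,1])$ the set of continuous functions $X\to[0,1]$, $\vee$ is the pointwise maximum, $c_X$ the constant function with value $c$. Conventions: $\ln(0)=-\infty$, $-\infty+x=-\infty$, $-\infty\vee x=x$. Idempotent measures: $I(X)=IX$ is the set of functionals $\mu:C(X)\to\mathbb{R}$ with $\mu(1_X)=1$, $\mu(\lambda_X+\varphi)=\lambda+\mu(\varphi)$ for $\lambda\in\mathbb{R}$, $\varphi\in C(X)$, and $\mu(\psi\vee\varphi)=\mu(\psi)\vee\mu(\varphi)$ for $\psi,\varphi\in C(X)$; it is topologized as a subspace of $\mathbb{R}^{C(X)}$ (product topology). $\cdot$-measures: $A^\cdot(X)$ is the set of functionals $\mu:C(X,[0,1])\to[0,1]$ with $\mu(1_X)=1$, $\mu(\lambda_X\cdot\varphi)=\lambda\cdot\mu(\varphi)$ for $\lambda\in[0,1]$, and $\mu(\psi\vee\varphi)=\mu(\psi)\vee\mu(\varphi)$ for $\psi,\varphi\in C(X,[0,1])$; it is topologized as a subspace of $[0,1]^{C(X,[0,1])}$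 (product topology). A subset $A\subset[0,1]^T$ is max-$\cdot$ convex if $\lambda\cdot a\vee b\in A$ for all $a,b\in A$, $\lambda\in[0,1]$ (coordinatewise operations, $\cdot$ having priority over $\vee$); a max-$\cdot$ convex compactum is a compact max-$\cdot$ convex subset of some $[0,1]^T$. A subset $A\subset\mathbb{R}^\tau$ is max-plus convex if $(\alpha+a)\vee b\in A$ for all $a,b\in A$, $\alpha\in[-\infty,0]$ (coordinatewise operations). A $(\cdot,+)$-affine embedding $h:K\to\mathbb{R}^\tau$ is a continuous map that is a homeomorphism onto its image and satisfies $h(\lambda\cdot s\vee k)=(\ln(\lambda)+h(s))\vee h(k)$ for all $\lambda\in[0,1]$, $s,k\in K$. Its image $S=h(K)$ is then a compact max-plus convex subset of $\mathbb R^\tau$. Barycenter maps: for a compact max-plus convex $S\subset\mathbb{R}^\tau$, $\beta_S:I(S)\to S$ is defined by letting the $t$-th coordinate of $\beta_S(\mu)$ be $\mu(\mathrm{pr}_t|_S)$, where $\mathrm{pr}_t$ is the $t$-th coordinate projection. For a compact max-$\cdot$ convex $K\subset[0,1]^T$, $\beta^\cdot_K:A^\cdot(K)\to K$ is defined by letting the $t$-th coordinate of $\beta^\cdot_K(\mu)$ be $\mu(\mathrm{pr}_t|_K)$. (It is known that these are well-defined continuous maps into $S$ and $K$ respectively.) The map $l_h:A^\cdot(K)\to I(S)$ is defined by $$l_h(\nu)(\psi)=\max\{\psi(h(x))+\inf\{\ln(\nu(\varphi))\mid \varphi\in C(K,[0,1]),\ \varphi(x)=1\}\mid x\in K\}$$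 for $\nu\in A^\cdot(K)$ and $\psi\in C(S)$. *)

(* Defs.v *)
From HB Require Import structures.
From mathcomp Require Import all_boot all_order all_algebra.
From mathcomp Require Import all_classical all_reals all_analysis.

Set Implicit Arguments.
Unset Strict Implicit.
Unset Printing Implicit Defensive.

Import Order.TTheory GRing.Theory Num.Theory.
Import numFieldNormedType.Exports.

Local Open Scope classical_set_scope.
Local Open Scope ring_scope.

(* A set used as a type stands for [set_type], which carries the subspace
   topology; [{ptws U -> V}] is the power V^U with the product topology. *)
Definition I01 (R : realType) : set R := `[0, 1].
Arguments I01 : clear implicits.

Definition homeomorphism (X Y : topologicalType) (f : X -> Y) : Prop :=
  exists g : Y -> X, [/\ continuous f, continuous g, cancel f g & cancel g f].

Section UnitInterval.
Variable R : realType.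
Implicit Types a b : I01 R.

Lemma one01_subproof : (1 : R) \in I01 R.
Proof. by rewrite inE /I01 /= in_itv /= ler01 lexx. Qed.

Definition one01 : I01 R := SigSub one01_subproof.

Lemma mul01_subproof a b : val a * val b \in I01 R.
Proof.
case: a b => [a /=]; rewrite inE /I01 /= in_itv /= => /andP[a0 a1].
move=> [b /=]; rewrite inE /I01 /= in_itv /= => /andP[b0 b1].
by rewrite inE /= in_itv /= mulr_ge0 //= mulr_ile1.
Qed.

Definition mul01 a b : I01 R := SigSub (mul01_subproof a b).

Lemma max01_subproof a b : Num.max (val a) (val b) \in I01 R.
Proof. by rewrite maxEle; case: ifP => _; apply: valP. Qed.

Definition max01 a b : I01 R := SigSub (max01_subproof a b).

Lemma continuous_to01 (X : topologicalType) (f : X -> I01 R) :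
  continuous (fun x => val (f x)) -> continuous f.
Proof.
move=> cf; apply/continuousP => _ [B oB <-].
exact: (continuousP _).1 cf B oB.
Qed.

Lemma val01_continuous : continuous (val : I01 R -> R).
Proof. exact: initial_continuous. Qed.

End UnitInterval.

Section FunctionOperations.
Variables (R : realType) (X : topologicalType).

Lemma cshift_subproof (l : R) (f : continuousType X R) :
  continuous (fun x => l + f x).
Proof. by move=> x; apply: cvgD; [exact: cvg_cst|exact: cts_fun]. Qed.

Definition cshift l f : continuousType X R := mkcts (@cshift_subproof l f).

Lemma cmax_subproof (f g : continuousType X R) :
  continuous (fun x => Num.max (f x) (g x)).
Proof. by move=> x; apply: (@continuous_max R X f g x); exact: cts_fun. Qed.

Definition cmax f g : continuousType X R := mkcts (@cmax_subproof f g).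

Lemma cscale01_subproof (l : I01 R) (f : continuousType X (I01 R)) :
  continuous (fun x => mul01 l (f x)).
Proof.
apply: continuous_to01 => x /=; apply: cvgM; first exact: cvg_cst.
by apply: continuous_comp; [exact: cts_fun|exact: val01_continuous].
Qed.

Definition cscale01 l f : continuousType X (I01 R) :=
  mkcts (@cscale01_subproof l f).

Lemma cmax01_subproof (f g : continuousType X (I01 R)) :
  continuous (fun x => max01 (f x) (g x)).
Proof.
apply: continuous_to01 => x /=.
apply: (@continuous_max R X (val \o f) (val \o g) x).
  by apply: continuous_comp; [exact: cts_fun|exact: val01_continuous].
by apply: continuous_comp; [exact: cts_fun|exact: val01_continuous].
Qed.

Definition cmax01 f g : continuousType X (I01 R) :=
  mkcts (@cmax01_subproof f g).

End FunctionOperations.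

Section Measures.
Variables (R : realType) (X : topologicalType).

Definition idem_measure : set {ptws continuousType X R -> R} :=
  [set mu : {ptws continuousType X R -> R} |
    [/\ mu (cst 1) = 1,
        forall (l : R) f, mu (cshift l f) = l + mu f &
        forall f g, mu (cmax f g) = Num.max (mu f) (mu g)]].

Definition dot_measure : set {ptws continuousType X (I01 R) -> I01 R} :=
  [set nu : {ptws continuousType X (I01 R) -> I01 R} |
    [/\ nu (cst (one01 R)) = one01 R,
        forall l f, nu (cscale01 l f) = mul01 l (nu f) &
        forall f g, nu (cmax01 f g) = max01 (nu f) (nu g)]].

End Measures.
Arguments idem_measure : clear implicits.
Arguments dot_measure : clear implicits.

Section Convexity.
Variables (R : realType) (T : Type).
Implicit Types K : set {ptws T -> I01 R}.

Definition max_dot_comb (l : I01 R) (a b : {ptws T -> I01 R}) :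
    {ptws T -> I01 R} :=
  fun t => max01 (mul01 l (a t)) (b t).

Definition max_dot_convex K : Prop :=
  forall a b, K a -> K b -> forall l, K (max_dot_comb l a b).

Lemma sub_max_dot_comb_subproof K (Kconv : max_dot_convex K) l (s k : K) :
  max_dot_comb l (val s) (val k) \in K.
Proof. by apply/mem_set/Kconv; apply/set_mem/valP. Qed.

Definition sub_max_dot_comb K (Kconv : max_dot_convex K) l (s k : K) : K :=
  SigSub (sub_max_dot_comb_subproof Kconv l s k).

End Convexity.

Section CorestrictionAndProjections.

Lemma corestrict_subproof (X Y : Type) (h : X -> Y) x : h x \in range h.
Proof. by apply/mem_set; exists x. Qed.

Definition corestrict (X Y : Type) (h : X -> Y) (x : X) : range h :=
  SigSub (corestrict_subproof h x).

Lemma sub_proj_subproof (I : Type) (V : topologicalType)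
  (A : set {ptws I -> V}) (i : I) : continuous (fun a : A => val a i).
Proof.
apply/continuousP => B oB.
exists ((fun f : {ptws I -> V} => f i) @^-1` B) => //.
move: B oB; apply/continuousP => f.
have /cvg_sup/(_ i) fi : f --> f by exact: cvg_id.
exact: (cvg_trans (cvg_app _ fi) (@initial_continuous _ V (@^~ i) f)).
Qed.

Definition sub_proj (I : Type) (V : topologicalType)
    (A : set {ptws I -> V}) (i : I) : continuousType A V :=
  mkcts (@sub_proj_subproof I V A i).

End CorestrictionAndProjections.

(* [lne] is the logarithm with [lne 0 = -oo]; working in the extended reals
   covers the case [l = 0]. *)
Definition dot_plus_affine_embedding (R : realType) (T J : Type)
    (K : set {ptws T -> I01 R}) (Kconv : max_dot_convex K)
    (h : K -> {ptws J -> R}) : Prop :=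
  [/\ continuous h, homeomorphism (corestrict h) &
      forall (l : I01 R) (s k : K) (j : J),
        (h (sub_max_dot_comb Kconv l s k) j)%:E =
        maxe (lne (val l)%:E + (h s j)%:E)%E (h k j)%:E].

(* Each of the next predicates determines its map uniquely. The values of the
   maps lie in subtypes, so the existence of such a map is exactly the
   well-definedness of the corresponding formula. *)
Definition is_dot_barycenter_map (R : realType) (T : Type)
    (K : set {ptws T -> I01 R}) (b : dot_measure R K -> K) : Prop :=
  forall nu t, val (b nu) t = val nu (sub_proj K t).

Definition is_barycenter_map (R : realType) (J : Type)
    (S : set {ptws J -> R}) (b : idem_measure R S -> S) : Prop :=
  forall mu j, val (b mu) j = val mu (sub_proj S j).

Definition is_maximum (R : realType) (A : set (\bar R)) (m : \bar R) : Prop :=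
  A m /\ ubound A m.

Definition is_lh (R : realType) (T J : Type) (K : set {ptws T -> I01 R})
    (h : K -> {ptws J -> R})
    (l : dot_measure R K -> idem_measure R (range h)) : Prop :=
  forall (nu : dot_measure R K) (psi : continuousType (range h) R),
    is_maximum
      [set ((psi (corestrict h x))%:E +
            ereal_inf [set lne (val (val nu phi))%:E |
                       phi in [set phi : continuousType K (I01 R) |
                               phi x = one01 R]])%E | x in [set: K]]
      (val (l nu) psi)%:E.

(* Main.v *)
(** The formula for [l_h] is the max-integral form of conjugation by the
    logarithm, [l_h nu psi = c + ln (nu (exp (psi o h - c)))] for any constant
    [c >= psi o h]. The two agree because, by compactness of [K], every value
    [nu f] is attained: [nu f = l * f x] for some [x] and some [l] with
    [l * phi x <= nu phi] for all [phi]. The logarithmic form is visibly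
    continuous, and its inverse sends [mu] to
    [f |-> exp (mu (ln f o h^-1))], with [f] truncated from below by small
    positive constants; the truncation error is uniform in [mu], hence the
    inverse is continuous too.
    The barycenter [b] of [nu] is a cluster point of the directed set of the
    [k] in [K] with [pr_t k <= nu pr_t] and [pr_j (h k) <= l_h nu pr_j], which
    contains finite combinations of points [x] with coefficients [l] as above;
    so [b] lies in [K] and [h b] is the barycenter of [l_h nu]. *)

Require Import Defs.
From HB Require Import structures.
From mathcomp Require Import all_boot all_order all_algebra.
From mathcomp Require Import all_classical all_reals all_analysis.
From mathcomp Require Import ring lra.

Set Implicit Arguments.
Unset Strict Implicit.
Unset Printing Implicit Defensive.

Import Order.TTheory GRing.Theory Num.Theory.
Import numFieldNormedType.Exports.

Local Open Scope classical_set_scope.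
Local Open Scope ring_scope.

(** * Clamping to the unit interval and truncation from below *)

Section UnitIntervalComplements.
Variable R : realType.
Implicit Types (a b : I01 R) (r : R).

Lemma I01_ge0 a : 0 <= val a.
Proof. by have := set_mem (valP a); rewrite /I01 /= in_itv /= => /andP[]. Qed.

Lemma I01_le1 a : val a <= 1.
Proof. by have := set_mem (valP a); rewrite /I01 /= in_itv /= => /andP[]. Qed.

Lemma mul01E a b : val (mul01 a b) = val a * val b. Proof. by []. Qed.

Lemma max01E a b : val (max01 a b) = Num.max (val a) (val b). Proof. by []. Qed.

Lemma clamp01_subproof r : Num.max 0 (Num.min 1 r) \in I01 R.
Proof.
by rewrite inE /I01 /= in_itv /= le_max lexx /= ge_max ler01 ge_min lexx.
Qed.

Definition clamp01 r : I01 R := SigSub (clamp01_subproof r).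

Lemma clamp01_id r : 0 <= r <= 1 -> val (clamp01 r) = r.
Proof. by case/andP=> r0 r1; rewrite /= min_r // max_r. Qed.

Lemma clamp01_continuous : continuous clamp01.
Proof.
apply: continuous_to01 => r /=.
apply: (@continuous_max R R (cst 0) (Num.min 1) r); first exact: cvg_cst.
by apply: (@continuous_min R R (cst 1) id r); [exact: cvg_cst|exact: cvg_id].
Qed.

(* Pins down a measure at functions with zeros, whose logarithm is not
   available. *)
Lemma eq_max_small (b u v : R) : 0 < b -> 0 <= u -> 0 <= v ->
  (forall e, 0 < e <= b -> Num.max u e = Num.max v e) -> u = v.
Proof.
have key (x y : R) : 0 < b -> 0 <= x -> 0 <= y ->
    (forall e, 0 < e <= b -> Num.max x e = Num.max y e) -> x <= y.
  move=> b0 x0 y0 E; rewrite leNgt; apply/negP => yx.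
  have x_gt0 : 0 < x by exact: le_lt_trans yx.
  have e0 : 0 < Num.min b ((x + y) / 2).
    by rewrite lt_min b0 /=; lra.
  have := E _ (introT andP (conj e0 _)); rewrite ge_min lexx => /(_ isT).
  have ex : Num.min b ((x + y) / 2) < x by rewrite gt_min; apply/orP; right; lra.
  rewrite max_l; last exact: ltW.
  move=> xE; have : x < x by rewrite {1}xE gt_max yx ex.
  by rewrite ltxx.
move=> b0 u0 v0 E; apply/eqP; rewrite eq_le; apply/andP; split; apply: key => //.
by move=> e /E ->.
Qed.

(** Truncation at level [e] changes a nonnegative [F] by at most [e], so [F] is a uniform limit of
    its continuous truncations. *)
Lemma continuous_from_max (X : topologicalType) (F : X -> R) :
  (forall x, 0 <= F x) ->
  (forall e, 0 < e <= 1 -> continuous (fun x => Num.max (F x) e)) ->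
  continuous F.
Proof.
move=> F0 cF x; apply/cvgrPdist_le => e e0.
pose d := Num.min 1 (e / 2).
have d0 : 0 < d by rewrite lt_min ltr01 /=; lra.
have d1 : d <= 1 by rewrite ge_min lexx.
have de : d <= e / 2 by rewrite ge_min lexx orbT.
have near_max (y : R) : 0 <= y -> y <= Num.max y d <= y + d.
  by move=> y0; rewrite le_max lexx ge_max lerDl (ltW d0) lerDr y0.
have e2 : 0 < e / 2 by lra.
have := cF d; rewrite d0 d1 => /(_ isT x) /cvgrPdist_le /(_ _ e2).
apply: filterS => y.
have := near_max _ (F0 x); have := near_max _ (F0 y).
move=> /andP[? ?] /andP[? ?]; rewrite !ler_norml => /andP[? ?].
by apply/andP; split; lra.
Qed.

End UnitIntervalComplements.

(** * Maps into subspaces and powers; compactness *)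

Section TopologyComplements.

Lemma continuous_to_subtype (X Y : topologicalType) (A : set Y) (f : X -> A) :
  continuous (fun x => val (f x)) -> continuous f.
Proof.
move=> cf; apply/continuousP => _ [B oB <-].
exact: (continuousP _).1 cf B oB.
Qed.

Lemma continuous_to_ptws (X : topologicalType) (I : Type)
    (V : topologicalType) (f : X -> {ptws I -> V}) :
  (forall i, continuous (fun x => f x i)) -> continuous f.
Proof.
move=> cf x; apply/cvg_sup => i A [_ [[B oB <-] Bx] sBA].
apply: (@filterS _ (nbhs x) _ ((fun x => f x i) @^-1` B)).
  by move=> y; exact: sBA.
by apply: (cf i x); exact: open_nbhs_nbhs.
Qed.

Lemma compact_set_type (Y : topologicalType) (A : set Y) :
  compact A -> compact [set: A].
Proof.
move=> cA F FF _.
have FA : (val @ F) A.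
  apply: (@filterS _ F _ setT) => [x _|]; last exact: filterT.
  exact: set_mem (valP x).
have [p [Ap clp]] := cA (val @ F) _ FA.
exists (SigSub (mem_set Ap)); split => // B C FB.
move=> -[_ /= [[W oW <-] /= Wp] sWC].
have [] := clp (val @` B) W.
- by rewrite /=; apply: filterS FB => x Bx; exists x.
- exact: open_nbhs_nbhs.
move=> _ [[x Bx <-] Wx]; exists x; split => //; exact: sWC.
Qed.

(** Near-covering along the filter at [+oo]: close to [x], [f] stays below [f x + 1], hence below
    every larger [c]. *)
Lemma compact_bounded_above (R : realType) (X : topologicalType) (f : X -> R) :
  compact [set: X] -> continuous f -> exists c, forall x, f x <= c.
Proof.
move=> /compact_near_coveringP cX cf.
have [|c fc] := filter_ex (cX R +oo (fun c x => f x <= c) _ _).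
  move=> x _; exists ([set y | f y <= f x + 1], [set c | f x + 1 <= c]) => /=.
    split; last exact: nbhs_pinfty_ge (num_real _).
    move/cvgrPdist_le: (cf x) => /(_ 1 ltr01); apply: filterS => y /=.
    by rewrite ler_norml => /andP[? ?]; lra.
  by move=> [y c] /= [fy]; exact: le_trans.
by exists c => x; exact: fc.
Qed.

End TopologyComplements.

(** * Continuous functions with values in the unit interval *)

Section ClampedFunctions.
Variables (R : realType) (X : topologicalType).

Lemma cclamp_subproof (u : X -> R) :
  continuous u -> continuous (fun x => clamp01 (u x)).
Proof.
by move=> cu x; apply: continuous_comp; [exact: cu|exact: clamp01_continuous].
Qed.

Definition cclamp (u : X -> R) (cu : continuous u) : continuousType X (I01 R) :=
  mkcts (cclamp_subproof cu).

Lemma continuous_val01 (f : continuousType X (I01 R)) :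
  continuous (fun x => val (f x)).
Proof.
by move=> x; apply: continuous_comp; [exact: cts_fun|exact: val01_continuous].
Qed.

End ClampedFunctions.

(** * Max-product measures: monotonicity and attained values *)

Section DotMeasures.
Variables (R : realType) (X : topologicalType).
Implicit Types (nu : dot_measure R X) (f g : continuousType X (I01 R)).

Lemma dot_measure_norm nu : val nu (cst (one01 R)) = one01 R.
Proof. by have [] := set_mem (valP nu). Qed.

Lemma dot_measure_scale nu l f :
  val nu (cscale01 l f) = mul01 l (val nu f).
Proof. by have [] := set_mem (valP nu). Qed.

Lemma dot_measure_max nu f g :
  val nu (cmax01 f g) = max01 (val nu f) (val nu g).
Proof. by have [] := set_mem (valP nu). Qed.

Lemma dot_measure_cst nu (l : I01 R) : val nu (cst l) = l.
Proof.
have -> : cst l = cscale01 l (cst (one01 R)) :> continuousType X (I01 R).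
  by apply/continuousEP => x; apply: val_inj; rewrite /= mulr1.
by rewrite dot_measure_scale dot_measure_norm; apply: val_inj; rewrite /= mulr1.
Qed.

Lemma dot_measure_le nu f g :
  (forall x, val (f x) <= val (g x)) -> val (val nu f) <= val (val nu g).
Proof.
move=> fg; have <- : cmax01 f g = g.
  by apply/continuousEP => x; apply: val_inj; exact: max_r.
by rewrite dot_measure_max /= le_max lexx.
Qed.

(** The point mass at [x] scaled by [l] lies below [nu]. The largest such [l] is the infimum of
    [nu phi] over [phi] with [phi x = 1], whose logarithm occurs in the formula for [l_h]. *)
Definition dot_weight nu (x : X) (l : I01 R) : Prop :=
  forall f, val l * val (f x) <= val (val nu f).

(* With [M := nu f], if no point attains [M] then every [x] has some [phi] with
   [phi x = 1] and [f x * nu phi < M], so that [f] is locally below multiples of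
   [phi] of measure less than [M]; compactness and maxitivity give [nu f < M].
   Halving [f] keeps the multiples within [0, 1]. *)
Lemma dot_weight_attained nu f : compact [set: X] ->
  exists x l, dot_weight nu x l /\ val l * val (f x) = val (val nu f).
Proof.
move=> /compact_near_coveringP cX; set M := val (val nu f).
have half01 : (2^-1 : R) \in I01 R by rewrite inE /I01 /= in_itv /=; lra.
pose half : I01 R := SigSub half01.
apply: contrapT => noatt.
have M_gt0 : 0 < M.
  rewrite lt_neqAle I01_ge0 andbT; apply/eqP => M0; apply: noatt.
  have [[x _]|X0] := pselect ([set: X] !=set0).
    exists x, (clamp01 0); split; last by rewrite clamp01_id ?mul0r ?lexx ?ler01.
    by move=> g; rewrite clamp01_id ?mul0r ?lexx ?ler01 ?I01_ge0.
  (* On an empty space the constants 0 and 1 are one function, of measure both 0 and 1. *)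
  have := dot_measure_cst nu (clamp01 0).
  have -> : cst (clamp01 0) = cst (one01 R) :> continuousType X (I01 R).
    by apply/continuousEP => x; case: X0; exists x.
  rewrite dot_measure_norm => /(congr1 val); rewrite clamp01_id ?lexx ?ler01//=.
  by move/eqP; rewrite oner_eq0.
have M_le1 : M <= 1 by exact: I01_le1.
have small x : exists phi : continuousType X (I01 R),
    val (phi x) = 1 /\ val (f x) * val (val nu phi) < M.
  apply: contrapT => nosmall; apply: noatt.
  have bound (phi : continuousType X (I01 R)) :
      val (phi x) = 1 -> M <= val (f x) * val (val nu phi).
    by move=> phix; rewrite leNgt; apply/negP => ltM; apply: nosmall; exists phi.
  have Mf : M <= val (f x).
    by have := bound (cst (one01 R)) erefl; rewrite dot_measure_norm /= mulr1.
  have fx0 : 0 < val (f x) by exact: lt_le_trans Mf.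
  (* This quotient is the weight that would attain [M] at [x]. *)
  have l01 : 0 <= M / val (f x) <= 1.
    by rewrite divr_ge0 ?(ltW M_gt0) ?(ltW fx0)// ler_pdivrMr// mul1r.
  exists x, (clamp01 (M / val (f x))); split; last first.
    by rewrite clamp01_id// divfK// gt_eqF.
  move=> g; rewrite clamp01_id//; set a := g x.
  have [a0|a_gt0] := leP (val a) 0.
    apply: (@le_trans _ _ 0); last exact: I01_ge0.
    by rewrite mulr_ge0_le0// (andP l01).1.
  (* Dividing [g] by its value [a] at [x] and clamping gives [phi] with [phi x = 1] and
     [a * phi <= g], so the bound on [nu phi] passes to [g]. *)
  have cphi : continuous (fun y => val (g y) / val a).
    by move=> y; apply: cvgM; [exact: continuous_val01|exact: cvg_cst].
  have phix : val (cclamp cphi x) = 1.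
    by rewrite clamp01_id divff ?gt_eqF ?lexx ?ler01.
  have /dot_measure_le :
      forall y, val (cscale01 a (cclamp cphi) y) <= val (g y).
    move=> y /=; rewrite (maxr_pMr _ _ (ltW a_gt0)) mulr0 ge_max I01_ge0 /=.
    by rewrite (minr_pMr _ _ (ltW a_gt0)) ge_min (mulrC (val a) (_ / _)) divfK;
      rewrite ?gt_eqF// lexx orbT.
  move/(_ nu); rewrite dot_measure_scale mul01E; apply: le_trans.
  by rewrite mulrC ler_pM2l// ler_pdivrMr// mulrC; exact: bound.
(* The functions of measure below [M / 2] are directed under maximum; near-covering along the
   resulting filter turns local majorants of [f / 2] into a global one. *)
pose F := filter_from [set g | val (val nu g) < M / 2]
  (fun g => [set g' : continuousType X (I01 R) |
      (forall x, val (g x) <= val (g' x)) /\ val (val nu g') < M / 2]).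
have FF : ProperFilter F.
  apply: filter_from_proper; last by move=> g ltg; exists g.
  apply: filter_from_filter.
    exists (cst (clamp01 0)); rewrite /= dot_measure_cst clamp01_id ?lexx ?ler01//.
    lra.
  move=> g1 g2 /= ltg1 ltg2; exists (cmax01 g1 g2).
    by rewrite /= dot_measure_max /= gt_max ltg1.
  move=> g [/= leg ltg]; split; split => // x.
    by apply: le_trans (leg x); rewrite le_max lexx.
  by apply: le_trans (leg x); rewrite le_max lexx orbT.
have [||g [leg ltg]] := filter_ex (filterI
  (cX _ F (fun (g : continuousType X (I01 R)) x =>
    val (f x) / 2 <= val (g x)) _ _)
  (_ : F [set g | val (val nu g) < M / 2])).
- move=> x _; have [phi [phix ltM]] := small x.
  have nu0 := I01_ge0 (val nu phi); have nu1 := I01_le1 (val nu phi).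
  have f0 := I01_ge0 (f x); have f1 := I01_le1 (f x).
  (* With at most half the slack, [(f x + d) * nu phi < M] still holds while [f] has room to grow
     near [x]; [d <= 1] keeps [a] in [0, 1]. *)
  pose d := Num.min 1 ((M - val (f x) * val (val nu phi)) / 2).
  have d_gt0 : 0 < d by rewrite lt_min ltr01 /= divr_gt0 ?subr_gt0.
  have d_le1 : d <= 1 by rewrite ge_min lexx.
  have d_leM : d <= (M - val (f x) * val (val nu phi)) / 2.
    by rewrite ge_min lexx orbT.
  move: d d_gt0 d_le1 d_leM => d d_gt0 d_le1 d_leM.
  pose a := (val (f x) + d) / 2.
  have a01 : 0 <= a <= 1 by rewrite /a; apply/andP; split; lra.
  exists ([set y | val (f y) / 2 <= a * val (phi y)],
          [set g' : continuousType X (I01 R) |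
            forall y, a * val (phi y) <= val (g' y)]); last first.
    by move=> [y g] /= [] fy /(_ y); exact: le_trans.
  split => /=.
    have : \forall y \near x, 0 < a * val (phi y) - val (f y) / 2.
      have : (fun y => a * val (phi y) - val (f y) / 2) @ x -->
             a * val (phi x) - val (f x) / 2.
        by apply: cvgB; apply: cvgM => //;
          exact: continuous_val01 || exact: cvg_cst.
      by move/cvgr_gt; apply; rewrite phix /a; lra.
    by apply: filterS => y; rewrite subr_gt0 => /ltW.
  exists (cscale01 (clamp01 a) phi).
    rewrite /= dot_measure_scale mul01E clamp01_id// /a.
    have : d * val (val nu phi) <= d by rewrite ler_piMr// ltW.
    lra.
  by move=> g' [] + _ y => /(_ y); rewrite mul01E clamp01_id.
- exists (cst (clamp01 0)); last by move=> g [].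
  by rewrite /= dot_measure_cst clamp01_id ?lexx ?ler01//; lra.
- have /(@dot_measure_le nu) : forall y, val (cscale01 half f y) <= val (g y).
    by move=> y /=; rewrite mulrC; exact: (leg _ I).
  by rewrite dot_measure_scale /= mulrC leNgt ltg.
Qed.

End DotMeasures.

(** * Idempotent measures: constants and monotonicity *)

Section IdempotentMeasures.
Variables (R : realType) (Y : topologicalType).
Implicit Types (mu : idem_measure R Y) (f g : continuousType Y R).

Lemma cshiftE (l : R) f y : cshift l f y = l + f y. Proof. by []. Qed.

Lemma cmaxE f g y : cmax f g y = Num.max (f y) (g y). Proof. by []. Qed.

Lemma idem_measure_shift mu (l : R) f : val mu (cshift l f) = l + val mu f.
Proof. by have [] := set_mem (valP mu). Qed.

Lemma idem_measure_max mu f g :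
  val mu (cmax f g) = Num.max (val mu f) (val mu g).
Proof. by have [] := set_mem (valP mu). Qed.

Lemma idem_measure_cst mu (a : R) : val mu (cst a) = a.
Proof.
have -> : cst a = cshift (a - 1) (cst 1) :> continuousType Y R.
  by apply/continuousEP => y; rewrite cshiftE /= subrK.
by rewrite idem_measure_shift; have [-> _ _] := set_mem (valP mu); rewrite subrK.
Qed.

Lemma idem_measure_le mu f g : (forall y, f y <= g y) -> val mu f <= val mu g.
Proof.
move=> fg; have <- : cmax f g = g by apply/continuousEP => y; exact: max_r.
by rewrite idem_measure_max le_max lexx.
Qed.

End IdempotentMeasures.

(** * Exponential and logarithm against maxima *)

Section ExpLogMax.
Variable R : realType.
Implicit Types a b : R.

Lemma expR_max a b : expR (Num.max a b) = Num.max (expR a) (expR b).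
Proof.
by case: (leP a b) => [|/ltW] ab; [rewrite max_r|rewrite max_l];
  rewrite ?ler_expR.
Qed.

Lemma ln_max a b : 0 < a -> 0 < b ->
  ln (Num.max a b) = Num.max (ln a) (ln b).
Proof.
move=> a0 b0.
by rewrite -[in LHS](lnK a0) -[in LHS](lnK b0) -expR_max expRK.
Qed.

Lemma continuous_addr_ln (Z : topologicalType) (u : Z -> R) (c : R) :
  (forall z, 0 < u z) -> continuous u -> continuous (fun z => c + ln (u z)).
Proof.
move=> u0 cu z; apply: cvgD; first exact: cvg_cst.
by apply: continuous_comp; [exact: cu|exact: continuous_ln].
Qed.

End ExpLogMax.

(** * The logarithm as a homeomorphism between the two spaces of measures *)

Section Transfer.
Variables (R : realType) (X Y : topologicalType).
Hypothesis compactX : compact [set: X].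
Variables (k : X -> Y) (g : Y -> X).
Hypotheses (k_cont : continuous k) (g_cont : continuous g).
Hypotheses (kK : cancel k g) (gK : cancel g k).
Implicit Types (nu : dot_measure R X) (mu : idem_measure R Y).
Implicit Types (psi : continuousType Y R) (f : continuousType X (I01 R)).

Lemma cexp_subproof psi (c : R) : continuous (fun x => expR (psi (k x) - c)).
Proof.
move=> x; apply: (@continuous_comp _ _ _ (fun x => psi (k x) - c) expR).
  apply: cvgB; last exact: cvg_cst.
  by apply: continuous_comp; [exact: k_cont|exact: cts_fun].
exact: continuous_expR.
Qed.

Definition cexp psi c : continuousType X (I01 R) :=
  cclamp (@cexp_subproof psi c).

Lemma cexpE psi c x : psi (k x) <= c ->
  val (cexp psi c x) = expR (psi (k x) - c).
Proof. by move=> pc; rewrite clamp01_id// expR_ge0 expR_le1 subr_le0. Qed.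

Lemma comp_bounded_above psi : exists c, forall x, psi (k x) <= c.
Proof.
apply: compact_bounded_above => // x.
by apply: continuous_comp; [exact: k_cont|exact: cts_fun].
Qed.

(** By compactness [psi \o k] is bounded below as well, so the exponential dominates a positive
    constant, which is its own measure. This keeps the logarithms below finite. *)
Lemma cexp_gt0 nu psi c : (forall x, psi (k x) <= c) ->
  0 < val (val nu (cexp psi c)).
Proof.
move=> pc.
have [b pb] : exists b, forall x, - psi (k x) <= b.
  apply: compact_bounded_above => // x; apply: cvgN.
  by apply: continuous_comp; [exact: k_cont|exact: cts_fun].
(* The minimum keeps [e <= 1] also when [X] is empty. *)
pose e := expR (Num.min 0 (- b - c)).
have e01 : 0 <= e <= 1 by rewrite expR_ge0 expR_le1 ge_min lexx.
have : e <= val (val nu (cexp psi c)).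
  rewrite -[e](clamp01_id e01) -[clamp01 e](dot_measure_cst nu).
  apply: dot_measure_le => x; rewrite clamp01_id// cexpE// ler_expR.
  by rewrite ge_min; apply/orP; right; have := pb x; lra.
by apply: lt_le_trans; exact: expR_gt0.
Qed.

(** For [c <= d] the two exponentials differ by the factor [expR (c - d)], which homogeneity and the
    logarithm turn into the shift [c - d]. *)
Lemma cexp_change_bound nu psi c d :
  (forall x, psi (k x) <= c) -> (forall x, psi (k x) <= d) ->
  c + ln (val (val nu (cexp psi c))) = d + ln (val (val nu (cexp psi d))).
Proof.
wlog cd : c d / c <= d => [hw pc pd|pc pd].
  by case: (leP c d) => [|/ltW] cd; [exact: hw|rewrite (hw d c)].
have e01 : 0 <= expR (c - d) <= 1 by rewrite expR_ge0 expR_le1 subr_le0.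
have -> : cexp psi d = cscale01 (clamp01 (expR (c - d))) (cexp psi c).
  apply/continuousEP => x; apply: val_inj.
  by rewrite mul01E clamp01_id// !cexpE// -expRD; congr expR; ring.
rewrite dot_measure_scale mul01E clamp01_id// lnM ?posrE ?expR_gt0 ?cexp_gt0//.
by rewrite expRK; ring.
Qed.

(* Subtracting [c] brings [expR (psi \o k - c)] into [0, 1]. *)
Definition log_functional nu : {ptws continuousType Y R -> R} := fun psi =>
  let c := sval (cid (comp_bounded_above psi)) in
  c + ln (val (val nu (cexp psi c))).

Lemma log_functionalE nu psi c : (forall x, psi (k x) <= c) ->
  log_functional nu psi = c + ln (val (val nu (cexp psi c))).
Proof.
move=> pc; apply: cexp_change_bound => //.
exact: (svalP (cid (comp_bounded_above psi))).
Qed.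

Lemma log_measure_subproof nu : log_functional nu \in idem_measure R Y.
Proof.
apply/mem_set; split.
- rewrite (@log_functionalE _ _ 1)//.
  have -> : cexp (cst 1) 1 = cst (one01 R).
    by apply/continuousEP => x; apply: val_inj; rewrite cexpE//= subrr expR0.
  by rewrite dot_measure_norm ln1 addr0.
- move=> l psi; have [c pc] := comp_bounded_above psi.
  rewrite (log_functionalE _ pc) (@log_functionalE _ _ (l + c)); last first.
    by move=> x; rewrite /= lerD2l.
  have -> : cexp (cshift l psi) (l + c) = cexp psi c.
    apply/continuousEP => x; apply: val_inj; rewrite !cexpE//; last first.
      by rewrite /= lerD2l.
    by congr expR; rewrite cshiftE; ring.
  by rewrite addrA.
- move=> psi phi; have [a pa] := comp_bounded_above psi.
  have [b pb] := comp_bounded_above phi.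
  pose c := Num.max a b.
  have pc x : psi (k x) <= c by rewrite le_max pa.
  have qc x : phi (k x) <= c by rewrite le_max pb orbT.
  have mc x : cmax psi phi (k x) <= c by rewrite ge_max pc qc.
  rewrite (log_functionalE _ pc) (log_functionalE _ qc) (log_functionalE _ mc).
  have -> : cexp (cmax psi phi) c = cmax01 (cexp psi c) (cexp phi c).
    apply/continuousEP => x; apply: val_inj.
    by rewrite max01E !cexpE// -expR_max addr_maxl.
  by rewrite dot_measure_max max01E ln_max ?cexp_gt0// addr_maxr.
Qed.

Definition log_measure nu : idem_measure R Y := SigSub (log_measure_subproof nu).

(** The chosen bound depends on [psi] alone, so each coordinate is a constant plus the logarithm of
    a positive coordinate of [nu]. *)
Lemma log_measure_continuous : continuous log_measure.
Proof.
apply: continuous_to_subtype; apply: continuous_to_ptws => psi.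
apply: continuous_addr_ln => [nu|nu].
  by apply: cexp_gt0; exact: (svalP (cid (comp_bounded_above psi))).
apply: (@continuous_comp _ _ _ (fun nu' : dot_measure R X =>
   val nu' (cexp psi _)) (val : I01 R -> R)); last exact: val01_continuous.
exact: (@sub_proj_subproof _ _ (dot_measure R X)).
Qed.

(* The truncation of [f] from below by [expR t] keeps the logarithm finite where
   [f] vanishes. *)
Lemma clog_subproof f (t : R) :
  continuous (fun y => ln (Num.max (val (f (g y))) (expR t))).
Proof.
move=> y; apply: (@continuous_comp _ _ _
  (fun y => Num.max (val (f (g y))) (expR t)) (@ln R)).
  apply: (@continuous_max R Y (fun y => val (f (g y))) (cst (expR t)) y).
    apply: (@continuous_comp _ _ _ g (fun x => val (f x))); first exact: g_cont.
    exact: continuous_val01.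
  exact: cvg_cst.
by apply: continuous_ln; rewrite lt_max expR_gt0 orbT.
Qed.

Definition clog f t : continuousType Y R := mkcts (@clog_subproof f t).

Lemma clogE f t y : clog f t y = ln (Num.max (val (f (g y))) (expR t)).
Proof. by []. Qed.

Lemma clog_max f s t : s <= t -> clog f t = cmax (clog f s) (cst t).
Proof.
move=> st; apply/continuousEP => y; rewrite clogE.
rewrite -[RHS]/(Num.max (ln (Num.max (val (f (g y))) (expR s))) t).
rewrite -[X in _ = Num.max _ X](expRK t) -ln_max;
  rewrite ?expR_gt0 ?lt_max ?expR_gt0 ?orbT//.
by rewrite -maxA [Num.max (expR s) _]max_r// ler_expR.
Qed.

(** The values are nondecreasing in [t], so the infimum is their limit at [-oo], where the
    truncation disappears. *)
Definition exp_functional mu f : R :=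
  inf [set expR (val mu (clog f t)) | t in [set t | t <= 0]].

(** Raising the level from [s] to [u] only takes the maximum with [expR u]. Hence a value exceeding
    [expR t] persists at all lower levels and is the infimum; otherwise the value is [expR t], which
    bounds the infimum from above. *)
Lemma exp_functional_max mu f t : t <= 0 ->
  Num.max (exp_functional mu f) (expR t) = expR (val mu (clog f t)).
Proof.
move=> t0; pose E := [set expR (val mu (clog f s)) | s in [set s | s <= 0]].
have E_lb : has_lbound E by exists 0 => _ [s _ <-]; exact: expR_ge0.
have Et : E (expR (val mu (clog f t))) by exists t.
have mono s u : s <= u ->
    expR (val mu (clog f u)) = Num.max (expR (val mu (clog f s))) (expR u).
  move=> su.
  by rewrite (clog_max f su) idem_measure_max idem_measure_cst expR_max.
have v_le : exp_functional mu f <= expR (val mu (clog f t)) by exact: ge_inf.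
have [lt_t|le_t] := ltP (expR t) (expR (val mu (clog f t))); last first.
  have -> : expR (val mu (clog f t)) = expR t.
    by apply/eqP; rewrite eq_le le_t /= (mono t t)// le_max lexx orbT.
  by rewrite max_r// (le_trans v_le).
have -> : exp_functional mu f = expR (val mu (clog f t)).
  apply/eqP; rewrite eq_le v_le /=; apply: lb_le_inf.
    by exists (expR (val mu (clog f t))).
  move=> _ [s _ <-]; have [st|/ltW ts] := leP s t.
    move: lt_t; rewrite (mono s t)// lt_max ltxx orbF => lt_s.
    by rewrite ge_max lexx ltW.
  by rewrite (mono t s)// le_max lexx.
by rewrite max_l// ltW.
Qed.

Lemma exp_functional_ge0 mu f : 0 <= exp_functional mu f.
Proof.
apply: lb_le_inf; first by exists (expR (val mu (clog f 0))), 0 => /=.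
by move=> _ [s _ <-]; exact: expR_ge0.
Qed.

Lemma exp_functional_le1 mu f : exp_functional mu f <= 1.
Proof.
have : exp_functional mu f <= expR (val mu (clog f 0)).
  by rewrite -exp_functional_max// le_max lexx.
move/le_trans; apply; rewrite expR_le1 -[leRHS](idem_measure_cst mu).
apply: idem_measure_le => y; apply: ln_le0.
by rewrite expR0 ge_max lexx I01_le1.
Qed.

(** Truncations at levels in (0, 1] determine a nonnegative number, so values are identified without
    computing the infimum. *)
Lemma exp_functionalP mu f (v : R) : 0 <= v ->
  (forall t, t <= 0 -> Num.max v (expR t) = expR (val mu (clog f t))) ->
  exp_functional mu f = v.
Proof.
move=> v0 H; apply: (@eq_max_small _ 1) => //; first exact: exp_functional_ge0.
move=> e /andP[e0 e1]; rewrite -(lnK e0) exp_functional_max ?H//; exact: ln_le0.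
Qed.

Definition exp_map mu : {ptws continuousType X (I01 R) -> I01 R} :=
  fun f => clamp01 (exp_functional mu f).

Lemma exp_mapE mu f : val (exp_map mu f) = exp_functional mu f.
Proof. by rewrite clamp01_id// exp_functional_ge0 exp_functional_le1. Qed.

Lemma exp_measure_subproof mu : exp_map mu \in dot_measure R X.
Proof.
apply/mem_set; split.
- apply: val_inj; rewrite exp_mapE; apply: exp_functionalP => //= t t0.
  rewrite max_l; last by rewrite expR_le1.
  have -> : clog (cst (one01 R)) t = cst 0.
    by apply/continuousEP => y; rewrite clogE max_l ?ln1//= expR_le1.
  by rewrite idem_measure_cst expR0.
- move=> l f; apply: val_inj; rewrite mul01E !exp_mapE.
  have [l0|l0] := leP (val l) 0.
    have -> : val l = 0 by apply/eqP; rewrite eq_le l0 I01_ge0.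
    rewrite mul0r; apply: exp_functionalP => // t t0; rewrite max_r ?expR_ge0//.
    have -> : clog (cscale01 l f) t = cst t; last by rewrite idem_measure_cst.
    apply/continuousEP => y; rewrite clogE mul01E max_r ?expRK//.
    by apply: (@le_trans _ _ 0); [rewrite mulr_le0_ge0// I01_ge0|exact: expR_ge0].
  (* Truncating [l * f] at [e] is [l] times truncating [f] at [e / l]; [e <= l] keeps that level at
     most 1, as the truncation formula requires. *)
  apply: (@eq_max_small _ (val l)) => //; first exact: exp_functional_ge0.
    by rewrite mulr_ge0 ?I01_ge0 ?exp_functional_ge0.
  move=> e /andP[e0 el].
  have t0 : ln e - ln (val l) <= 0 by rewrite subr_le0 ler_ln.
  have eE : e = val l * expR (ln e - ln (val l)).
    by rewrite expRD expRN !lnK// mulrCA divff ?mulr1// gt_eqF.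
  rewrite {2}eE -maxr_pMr ?I01_ge0// exp_functional_max//.
  rewrite -{1}(lnK e0) exp_functional_max; last first.
    by apply: ln_le0; apply: le_trans el (I01_le1 _).
  rewrite -[X in _ = X * _](lnK l0) -expRD -idem_measure_shift.
  congr (expR (val mu _)).
  apply/continuousEP => y; rewrite cshiftE !clogE mul01E.
  rewrite -lnM ?posrE// ?lt_max ?expR_gt0 ?orbT// maxr_pMr ?I01_ge0//.
  by rewrite -eE lnK.
- move=> f1 f2; apply: val_inj; rewrite max01E !exp_mapE.
  apply: exp_functionalP => [|t t0]; first by rewrite le_max exp_functional_ge0.
  have -> : clog (cmax01 f1 f2) t = cmax (clog f1 t) (clog f2 t).
    apply/continuousEP => y; rewrite cmaxE !clogE max01E -ln_max;
      rewrite ?lt_max ?expR_gt0 ?orbT//.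
    by rewrite maxACA maxxx.
  by rewrite idem_measure_max expR_max -!exp_functional_max// maxACA maxxx.
Qed.

Definition exp_measure mu : dot_measure R X := SigSub (exp_measure_subproof mu).

(** Truncated at [e], a coordinate of the inverse is [expR (mu (clog f (ln e)))], which is
    continuous in [mu]. *)
Lemma exp_measure_continuous : continuous exp_measure.
Proof.
apply: continuous_to_subtype; apply: continuous_to_ptws => f.
apply: continuous_to01; apply: continuous_from_max => [mu|e /andP[e0 e1]].
  exact: I01_ge0.
have -> : (fun mu => Num.max (val (val (exp_measure mu) f)) e) =
    fun mu => expR (val mu (clog f (ln e))).
  apply/funext => mu; rewrite -exp_functional_max; last exact: ln_le0.
  by rewrite lnK// -exp_mapE.
move=> mu; apply: (@continuous_comp _ _ _ (fun mu' : idem_measure R Y =>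
  val mu' (clog f (ln e))) expR); last exact: continuous_expR.
exact: (@sub_proj_subproof _ _ (idem_measure R Y)).
Qed.

(** With the bound 0, exponentiating the truncated logarithm of [f] returns the maximum of [f] and
    [expR t], whose measure is the truncation of [nu f]. *)
Lemma log_measureK : cancel log_measure exp_measure.
Proof.
move=> nu; apply: val_inj; apply/funext => f; apply: val_inj.
rewrite exp_mapE; apply: exp_functionalP => [|t t0]; first exact: I01_ge0.
have et : 0 <= expR t <= 1 by rewrite expR_ge0 expR_le1.
have c0 x : clog f t (k x) <= 0.
  by apply: ln_le0; rewrite ge_max I01_le1 expR_le1.
rewrite /= (log_functionalE _ c0) add0r lnK ?posrE ?cexp_gt0//.
have -> : cexp (clog f t) 0 = cmax01 f (cst (clamp01 (expR t))).
  apply/continuousEP => x; apply: val_inj.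
  rewrite cexpE// max01E clamp01_id// subr0 clogE kK lnK//.
  by rewrite posrE lt_max expR_gt0 orbT.
by rewrite dot_measure_max dot_measure_cst max01E clamp01_id.
Qed.

(** The logarithm of [expR (psi - c)] truncated at [t] is the maximum of [psi - c] and [t], so the
    inverse takes the value [expR (mu psi - c)] at [cexp psi c]. *)
Lemma exp_measureK : cancel exp_measure log_measure.
Proof.
move=> mu; apply: val_inj; apply/funext => psi /=.
have [c pc] := comp_bounded_above psi; rewrite (log_functionalE _ pc).
rewrite exp_mapE (@exp_functionalP _ _ (expR (- c + val mu psi))).
- by rewrite expRK addrA subrr add0r.
- exact: expR_ge0.
move=> t t0; have -> : clog (cexp psi c) t = cmax (cshift (- c) psi) (cst t).
  apply/continuousEP => y.
  rewrite cmaxE cshiftE clogE cexpE// ln_max ?expR_gt0// !expRK gK.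
  by rewrite addrC.
by rewrite idem_measure_max idem_measure_shift idem_measure_cst expR_max.
Qed.

Lemma log_measure_homeomorphism : homeomorphism log_measure.
Proof.
exists exp_measure; split.
- exact: log_measure_continuous.
- exact: exp_measure_continuous.
- exact: log_measureK.
- exact: exp_measureK.
Qed.

(** * The max-integral formula for the logarithmic form *)

Lemma dot_weight_le_log nu x (l : I01 R) psi : dot_weight nu x l ->
  0 < val l -> ln (val l) + psi (k x) <= val (log_measure nu) psi.
Proof.
move=> wl l0; have [c pc] := comp_bounded_above psi.
rewrite /= (log_functionalE _ pc).
have := wl (cexp psi c); rewrite cexpE// -{1}(lnK l0) -expRD.
by rewrite -[leRHS]lnK ?posrE ?cexp_gt0// ler_expR; lra.
Qed.

Lemma log_measure_attained nu psi : exists x (l : I01 R),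
  [/\ dot_weight nu x l, 0 < val l &
      ln (val l) + psi (k x) = val (log_measure nu) psi].
Proof.
have [c pc] := comp_bounded_above psi.
have [x [l [wl lE]]] := dot_weight_attained nu (cexp psi c) compactX.
have := cexp_gt0 nu pc; rewrite -lE pmulr_lgt0 ?cexpE ?expR_gt0// => l0.
exists x, l; split => //; rewrite /= (log_functionalE _ pc) -lE cexpE//.
by rewrite lnM ?posrE ?expR_gt0// expRK; ring.
Qed.

Lemma log_measure_maximum nu psi :
  is_maximum
    [set ((psi (k x))%:E +
          ereal_inf [set lne (val (val nu phi))%:E |
                     phi in [set phi : continuousType X (I01 R) |
                             phi x = one01 R]])%E | x in [set: X]]
    (val (log_measure nu) psi)%:E.
Proof.
have [c pc] := comp_bounded_above psi.
pose d x := ereal_inf [set lne (val (val nu phi))%:E |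
  phi in [set phi : continuousType X (I01 R) | phi x = one01 R]].
have ub x : ((psi (k x))%:E + d x <= (val (log_measure nu) psi)%:E)%E.
  (* Test function for the infimum at [x]: it is 1 at [x], and scaled by [expR (psi (k x) - c)] it
     stays below [cexp psi c], thanks to the clamp where [psi \o k] exceeds [psi (k x)]. *)
  pose phi := cexp psi (psi (k x)).
  have phix : phi x = one01 R by apply: val_inj; rewrite cexpE// subrr expR0.
  apply: (@le_trans _ _ ((psi (k x))%:E + lne (val (val nu phi))%:E)%E).
    by rewrite leeD2l//; apply: ereal_inf_lbound; exists phi.
  have [nu0|nu0] := leP (val (val nu phi)) 0.
    by rewrite le0_lneNy ?lee_fin// addeNy leNye.
  rewrite lne_EFin// -EFinD lee_fin /= (log_functionalE _ pc).
  have e01 : 0 <= expR (psi (k x) - c) <= 1.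
    by rewrite expR_ge0 expR_le1 subr_le0 pc.
  have /(@dot_measure_le _ _ nu) : forall y,
      val (cscale01 (clamp01 (expR (psi (k x) - c))) phi y) <=
      val (cexp psi c y).
    move=> y; rewrite mul01E clamp01_id// (cexpE (pc y)).
    have [yx|/ltW xy] := leP (psi (k y)) (psi (k x)).
      by rewrite (cexpE yx) -expRD ler_expR; lra.
    apply: (@le_trans _ _ (expR (psi (k x) - c))).
      by rewrite ler_piMr ?expR_ge0// I01_le1.
    by rewrite ler_expR lerD2r.
  rewrite dot_measure_scale mul01E clamp01_id//.
  rewrite -ler_ln ?posrE ?mulr_gt0 ?expR_gt0 ?(cexp_gt0 nu pc)//.
  by rewrite lnM ?posrE ?expR_gt0// expRK; lra.
split; last by move=> _ [x _ <-]; exact: ub.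
(* A weight [l] at [x] is at most [nu phi] whenever [phi x = 1], so [ln l] lies below the infimum
   and this [x] attains the maximum. *)
have [x [l [wl l0 lE]]] := log_measure_attained nu psi.
exists x => //; apply/eqP; rewrite eq_le ub andTb -lE EFinD addeC leeD2l//.
apply/ereal_infP => _ [phi phix <-].
have lphi : val l <= val (val nu phi).
  by have := wl phi; rewrite phix /= mulr1.
have nu0 : 0 < val (val nu phi) by exact: lt_le_trans lphi.
by rewrite lne_EFin// lee_fin ler_ln.
Qed.

End Transfer.

(** * Existence of a point realizing both barycenters *)

Section Barycenters.
Variables (R : realType) (T J : Type) (K : set {ptws T -> I01 R}).
Hypotheses (Kconv : max_dot_convex K) (compactK : compact [set: K]).
Variables (h : K -> {ptws J -> R}).
Hypothesis corestrict_cont : continuous (corestrict h).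
Hypothesis h_affine : forall (l : I01 R) (s k : K) (j : J),
  (h (sub_max_dot_comb Kconv l s k) j)%:E =
  maxe (lne (val l)%:E + (h s j)%:E)%E (h k j)%:E.
Implicit Types (nu : dot_measure R K) (l : I01 R) (s k : K).

Lemma val_comb l s k t : val (val (sub_max_dot_comb Kconv l s k) t) =
  Num.max (val l * val (val s t)) (val (val k t)).
Proof. by []. Qed.

Lemma h_comb l s k j : 0 < val l ->
  h (sub_max_dot_comb Kconv l s k) j = Num.max (ln (val l) + h s j) (h k j).
Proof.
by move=> l0; apply: EFin_inj; rewrite h_affine lne_EFin// -EFinD EFin_max.
Qed.

(** For [l = 0] the first term is [-oo], hence the bound on [s] is asked for positive [l] only. *)
Lemma h_comb_le l s k j a : (0 < val l -> ln (val l) + h s j <= a) ->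
  h k j <= a -> h (sub_max_dot_comb Kconv l s k) j <= a.
Proof.
move=> sa ka; have [l0|l0] := leP (val l) 0.
  rewrite -lee_fin h_affine le0_lneNy ?lee_fin// addNye.
  by rewrite ge_max leNye lee_fin.
by rewrite h_comb// ge_max sa.
Qed.

Local Notation log_nu nu :=
  (log_measure compactK corestrict_cont nu).

Lemma barycenter_exists nu : exists b : K,
  (forall t, val b t = val nu (sub_proj K t)) /\
  (forall j, h b j = val (log_nu nu) (sub_proj (range h) j)).
Proof.
pose m j := val (log_nu nu) (sub_proj (range h) j).
pose D := [set k : K |
  (forall t, val (val k t) <= val (val nu (sub_proj K t))) /\
  (forall j, h k j <= m j)].
have weight_h x l j : dot_weight nu x l -> 0 < val l ->
    ln (val l) + h x j <= m j.
  move=> wl l0; exact: (dot_weight_le_log compactK corestrict_cont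
    (sub_proj (range h) j) wl l0).
have D_comb x l k : dot_weight nu x l -> D k -> D (sub_max_dot_comb Kconv l x k).
  move=> wl [kle hle]; split=> [t|j].
    by rewrite val_comb ge_max kle andbT; exact: (wl (sub_proj K t)).
  by apply: h_comb_le => // l0; exact: weight_h.
have D_max k1 k2 : D k1 -> D k2 -> D (sub_max_dot_comb Kconv (one01 R) k1 k2).
  move=> [le1 h1] [le2 h2]; split=> [t|j].
    by rewrite val_comb mul1r ge_max le1 le2.
  by apply: h_comb_le => // _; rewrite ln1 add0r.
have [x0 Dx0] : exists x0, D x0.
  (* The constant 1 has measure 1, so some point carries weight 1 and therefore lies in [D]. *)
  have [x [l [wl]]] := dot_weight_attained nu (cst (one01 R)) compactK.
  rewrite dot_measure_norm mulr1 -[RHS]/1 => l1; exists x; split=> [t|j].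
    by have := wl (sub_proj K t); rewrite l1 mul1r.
  by rewrite -[h x j]add0r -ln1 -l1; apply: weight_h; rewrite // l1.
(* Tails of [D] for the coordinatewise order, directed because combinations with coefficient 1 are
   joins. *)
pose F := filter_from D
  (fun k0 => [set k | D k /\ forall t, val (val k0 t) <= val (val k t)]).
have FF : ProperFilter F.
  apply: filter_from_proper; last by move=> k Dk; exists k.
  apply: filter_from_filter; first by exists x0.
  move=> k1 k2 D1 D2; exists (sub_max_dot_comb Kconv (one01 R) k1 k2).
    exact: D_max.
  move=> k [Dk kle]; split; split => // t; apply: le_trans (kle t).
    by rewrite val_comb mul1r le_max lexx.
  by rewrite val_comb le_max lexx orbT.
have [b [_ clb]] := compactK FF filterT.
have cluster_closed (u : K -> R) (C : set R) : continuous u -> closed C ->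
    F [set k | C (u k)] -> C (u b).
  move=> cu closedC FC; have : closed (u @^-1` C).
    by apply: preimage_closed => // ? _; exact: cu.
  by apply => B nB; exact: clb.
have bE t : val b t = val nu (sub_proj K t).
  apply: val_inj; apply: (cluster_closed (fun k => val (val k t))
    [set r | r = val (val nu (sub_proj K t))]).
  - exact: (continuous_val01 (f := sub_proj K t)).
  - exact: closed_eq.
  (* Above the combination of [x] and [x0], coordinate [t] is at least [l * x_t = nu pr_t];
     membership in [D] gives the reverse bound. *)
  have [x [l [wl lE]]] := dot_weight_attained nu (sub_proj K t) compactK.
  exists (sub_max_dot_comb Kconv l x x0); first exact: D_comb.
  move=> k [[kle _] /(_ t)]; rewrite val_comb => lek.
  apply/eqP; rewrite eq_le kle /= -lE; apply: le_trans lek.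
  by rewrite le_max lexx.
exists b; split => // j; apply/eqP; rewrite eq_le; apply/andP; split.
  apply: (cluster_closed (fun k => h k j) [set r | r <= m j]).
  - move=> k; exact: (continuous_comp (@corestrict_cont k)
      (@sub_proj_subproof _ _ (range h) j _)).
  - exact: closed_le.
  by exists x0 => // k [[_ +] _]; exact.
(* Since [l * x_t <= nu pr_t = b_t], adjoining [x] with coefficient [l] leaves [b] unchanged;
   affinity of [h] then gives [h b j >= ln l + h x j]. *)
have [x [l [wl l0 lE]]] :=
  log_measure_attained compactK corestrict_cont nu (sub_proj (range h) j).
rewrite -lE; have combE : sub_max_dot_comb Kconv l x b = b.
  apply: val_inj; apply/funext => t; apply: val_inj; apply: max_r.
  by rewrite bE; exact: (wl (sub_proj K t)).
by rewrite -combE h_comb// le_max lexx.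
Qed.

End Barycenters.

(** * Assembly of the homeomorphism between the two barycenter maps *)

Theorem theorem2 (R : realType) (T J : Type) (K : set {ptws T -> I01 R})
  (Kcompact : compact K) (Kconv : max_dot_convex K)
  (h : K -> {ptws J -> R}) (hh : dot_plus_affine_embedding Kconv h) :
  exists (bK : dot_measure R K -> K)
         (bS : idem_measure R (range h) -> range h)
         (lh : dot_measure R K -> idem_measure R (range h)),
    [/\ is_dot_barycenter_map bK, is_barycenter_map bS & is_lh lh] /\
    [/\ homeomorphism lh, homeomorphism (corestrict h) &
        corestrict h \o bK = bS \o lh].
Proof.
have [_ h_homeo h_affine] := hh.
have [g [ch cg hK gK]] := h_homeo.
have cK := compact_set_type Kcompact.
have bary nu := cid (barycenter_exists cK ch h_affine nu).
pose lh := @log_measure R _ _ cK _ ch; pose eh := @exp_measure R _ _ _ cg.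
have lhK : cancel lh eh by exact: log_measureK hK.
have ehK : cancel eh lh by exact: exp_measureK gK.
pose bK nu := sval (bary nu).
(* The barycenter map of [S] is obtained by transport: every [mu] is [lh (eh mu)], so its barycenter
   is the image under [h] of that of [eh mu]. *)
exists bK, (corestrict h \o bK \o eh), lh; split; split.
- by move=> nu t; have [] := svalP (bary nu).
- move=> mu j; have [_ /(_ j) hE] := svalP (bary (eh mu)).
  by rewrite -[in RHS](ehK mu); exact: hE.
- exact: log_measure_maximum.
- exact: log_measure_homeomorphism cg hK gK.
- exact: h_homeo.
- by apply/funext => nu; rewrite /= lhK.
Qed.
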